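(* Let $\vec{G}=(\mathcal{V},\vec{\mathcal{E}})$ be a directed acyclic graph with $n$ vertices such that the longest directed path in $\vec{G}$ has length $\ell\geq 1$. If $\vec{G}$ is extremely reduced, then $\vec{G}$ has at most $t(n-\ell+1,2)+T(n,\ell,1)$ edges.
   Context: A directed acyclic graph (DAG) is a simple directed graph without directed cycles. A directed path is a sequence of vertices $v_0,\dots,v_k$ such that $(v_{i-1},v_i)$ is a directed edge for every $1\le i\le k$; its length is $k$ (the number of edges). A vertex $w$ is an ancestor of $v$ if there is a directed path $w=v_0,\dots,v_k=v$ with $k\ge 1$, and $w$ is a descendant of $v$ if there is a directed path $v=v_0,\dots,v_k=w$ with $k\geq 1$. Two vertices are adjacent if there is a directed edge between them in either direction. A finite DAG is extremely reduced if for every pair of distinct non-adjacent vertices $x,y$, if $x,y$ have a common ancestor, then they do not have a common descendant. $t(m,2)$ denotes the number of edges of the $2$-partite Turán graph on $m$ vertices (the complete bipartite graph on $m$ vertices with part sizes differing by at most one), and $$T(n,\ell,1)=\binom{n}{2}-\binom{n-\ell+1}{2}=(n-\ell+1)(\ell-1)+\frac{(\ell-1)(\ell-2)}{2}.$$ *)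

(* Defs.v *)
From mathcomp Require Import all_boot.

Set Implicit Arguments.
Unset Strict Implicit.
Unset Printing Implicit Defensive.

(* A digraph on V is a relation e : rel V, with e x y meaning x -> y.  A
   directed path v_0, ..., v_k is [path e v_0 [:: v_1; ...; v_k]]; its length k
   is the size of the tail. *)
Section Digraph.
Variables (V : finType) (e : rel V).

(* Loops and opposite pairs of edges are cycles of size 1 and 2, so an acyclic
   relation is automatically a simple digraph. *)
Definition acyclic := forall c : seq V, c <> [::] -> ~~ cycle e c.

Definition longest_path_length (l : nat) :=
  (exists x p, path e x p /\ size p = l) /\
  (forall x p, path e x p -> size p <= l).

Definition ancestor (w v : V) :=
  exists p, [/\ 0 < size p, path e w p & last w p = v].

Definition descendant (w v : V) :=
  exists p, [/\ 0 < size p, path e v p & last v p = w].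

Definition adjacent (x y : V) := e x y || e y x.

Definition extremely_reduced :=
  forall x y, x != y -> ~~ adjacent x y ->
    (exists w, ancestor w x /\ ancestor w y) ->
    ~ (exists z, descendant z x /\ descendant z y).

Definition num_edges := #|[set xy : V * V | e xy.1 xy.2]|.

End Digraph.

(* The parts are the residue classes mod r, whose sizes differ by at most 1. *)
Definition turan_adj (m r : nat) : rel 'I_m := fun i j => i %% r != j %% r.

(* Each edge is counted once, as the pair (i, j) with i < j. *)
Definition turan_edges (m r : nat) :=
  #|[set ij : 'I_m * 'I_m | (ij.1 < ij.2) && turan_adj r ij.1 ij.2]|.

(* T(n, l, 1); no subtraction truncates when 1 <= l <= n. *)
Definition T1 (n l : nat) := 'C(n, 2) - 'C(n - l + 1, 2).

(* Main.v *)
Require Import Defs.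
From mathcomp Require Import all_boot zify.

Set Implicit Arguments.
Unset Strict Implicit.
Unset Printing Implicit Defensive.

(** The proof is Mantel's induction, deleting two vertices at a time, with a
    source and a sink playing the part of the two ends of an edge.

    Let [a] be a source and [b <> a] a sink of an induced subgraph.  A common
    neighbour [x] of [a] and [b] must satisfy [a -> x -> b].  Hence any two
    common neighbours share the ancestor [a] and the descendant [b], and so are
    adjacent, by extreme reducedness: the common neighbours form a tournament.
    A tournament has a Hamiltonian path, which extends to a path from [a] to
    [b]; therefore there are at most [l - 1] common neighbours
    ([card_between_lt]).  If [k] vertices remain after deleting [a] and [b], at
    most [k + (l - 1) + 1] edges are lost.  That is exactly the increment of
    the claimed bound: with [m = k - l + 1], the complete graph loses [2 k + 1]
    edges, the complete graph on [m + 2] vertices loses [2 m + 1], and the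
    Turan number loses [m + 1] ([turan_edges2_addn2]).

    Sources and sinks exist in every nonempty induced subgraph because path
    lengths are bounded.  The induction is over subsets of the vertex set with
    [l] fixed as a bound on path lengths; reducedness is always used in the
    whole graph, where the required ancestor and descendant are one edge
    away. *)

(** * Turan numbers for two parts *)

Lemma turan_edges_sum m r :
  turan_edges m r = \sum_(j < m) \sum_(i < j) (i %% r != j %% r).
Proof.
rewrite /turan_edges -sum1_card.
transitivity (\sum_(i < m) \sum_(j < m) ((i < j) && (i %% r != j %% r))%N).
  rewrite pair_bigA /= big_mkcond /=; apply: eq_bigr => -[i j] _.
  by rewrite inE /= /turan_adj; case: (_ && _).
rewrite exchange_big /=; apply: eq_bigr => j _.
rewrite (big_ord_widen_cond m xpredT (fun i => (i %% r != j %% r) : nat))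
  ?(ltnW (ltn_ord j)) //.
by rewrite [RHS]big_mkcond /=; apply: eq_bigr => i _; case: (_ < _).
Qed.

(** Each of the first [m] vertices is joined to exactly one of the two new
    vertices, which have opposite parities and so are joined to each other. *)
Lemma turan_edges2_addn2 m : turan_edges m.+2 2 = turan_edges m 2 + m.+1.
Proof.
rewrite !turan_edges_sum !big_ord_recr /= -addnA; congr (_ + _).
rewrite addnA -big_split /=.
have -> : (m %% 2 != m.+1 %% 2) by rewrite !modn2 /=; case: (odd m).
rewrite (eq_bigr (fun=> 1)) ?sum1_card ?card_ord ?addn1 // => i _.
by rewrite !modn2 /=; case: (odd i); case: (odd m).
Qed.

Lemma turan_edges1 r : turan_edges 1 r = 0.
Proof. by rewrite turan_edges_sum big_ord_recr !big_ord0. Qed.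

Lemma turan_edges22 : turan_edges 2 2 = 1.
Proof. by rewrite turan_edges2_addn2 turan_edges_sum big_ord0. Qed.

Lemma bin2_addn2 k : 'C(k.+2, 2) = 'C(k, 2) + k.*2.+1.
Proof. by rewrite !binS !bin1 !bin0; lia. Qed.

(** * Sources, sinks and the vertices between them *)

(** Otherwise predecessors within [S] could be prepended forever. *)
Lemma exists_source (V : finType) (e : rel V) (l : nat) (S : {set V}) :
    (forall x p, path e x p -> size p <= l) -> S != set0 ->
  exists2 a, a \in S & {in S, forall x, ~~ e x a}.
Proof.
move=> bound /set0Pn[s Ss].
have [/exists_inP[a Sa /forall_inP src] | nosrc] :=
  boolP [exists a in S, [forall x in S, ~~ e x a]]; first by exists a.
have [x [p [_ ep sz]]] :
    exists x p, [/\ x \in S, path e x p & size p = l.+1].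
  elim: l.+1 => [|k [x [p [Sx ep sz]]]]; first by exists s, [::].
  move: nosrc; rewrite negb_exists_in => /forall_inP/(_ x Sx).
  rewrite negb_forall_in => /exists_inP[y Sy /negPn eyx].
  by exists y, (x :: p); rewrite /= eyx ep sz.
by have := bound x p ep; rewrite sz ltnn.
Qed.

Lemma exists_sink (V : finType) (e : rel V) (l : nat) (S : {set V}) :
    (forall x p, path e x p -> size p <= l) -> S != set0 ->
  exists2 b, b \in S & {in S, forall x, ~~ e b x}.
Proof.
move=> bound; apply: (@exists_source V (fun x y => e y x) l) => x p ep.
by rewrite -(size_belast x p) -size_rev; apply: (bound (last x p)); rewrite rev_path.
Qed.

(** Sorting [K] by [e] yields a Hamiltonian path even though [e] need not be
    transitive, since sortedness only constrains consecutive entries. *)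
Lemma tournament_path (V : finType) (e : rel V) (K : {set V}) :
    {in K &, forall x y, x != y -> adjacent e x y} ->
  exists s, [/\ sorted e s, s =i K & size s = #|K|].
Proof.
(* Sorting needs a total relation, hence a reflexive one. *)
move=> adjK; pose r := [rel x y | (x == y) || e x y].
have r_total : {in mem K &, total r}.
  move=> x y Kx Ky /=; have [//|nxy] := eqVneq x y.
  by have := adjK x y Kx Ky nxy.
exists (sort r (enum K)); split; last by rewrite size_sort -cardE.
- have: sorted r (sort r (enum K)).
    by apply: (sort_sorted_in r_total); apply/allP=> x; rewrite mem_enum.
  have: uniq (sort r (enum K)) by rewrite sort_uniq enum_uniq.
  case: (sort _ _) => //= x s; elim: s x => //= y s IHs x.
  rewrite inE negb_or => /andP[/andP[/negPf-> _] us] /= /andP[-> rs].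
  by rewrite IHs.
- by move=> x; rewrite mem_sort mem_enum.
Qed.

Lemma card_between_lt (V : finType) (e : rel V) (l : nat) (a b : V) (K : {set V}) :
    1 <= l -> (forall x p, path e x p -> size p <= l) ->
    extremely_reduced e -> {in K, forall x, e a x && e x b} ->
  #|K| < l.
Proof.
move=> l_gt0 bound red btw.
have [|s [sorted_s sK <-]] := @tournament_path V e K.
  move=> x y Kx Ky nxy; apply/negPn/negP => nadj.
  have [[/andP[eax exb] /andP[eay eyb]]] := (btw x Kx, btw y Ky).
  apply: (red x y nxy nadj).
  - by exists a; split; [exists [:: x] | exists [:: y]]; rewrite /= ?eax ?eay.
  - by exists b; split; exists [:: b]; rewrite /= ?exb ?eyb.
case: s sorted_s sK => // x s /= sorted_s sK.
have /andP[eax _] : e a x && e x b by apply: btw; rewrite -sK mem_head.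
have /andP[_ elb] : e a (last x s) && e (last x s) b.
  by apply: btw; rewrite -sK mem_last.
suff /bound : path e a (rcons (x :: s) b) by rewrite size_rcons.
by rewrite /= eax rcons_path sorted_s.
Qed.

(** * The induction *)

Definition edges_in (V : finType) (e : rel V) (S : {set V}) :=
  \sum_(x in S) \sum_(y in S) e x y.

Lemma edges_in_setT (V : finType) (e : rel V) :
  edges_in e [set: V] = num_edges e.
Proof.
rewrite /edges_in /num_edges -sum1_card pair_big /= [RHS]big_mkcond [LHS]big_mkcond.
by apply: eq_bigr => -[x y] _; rewrite !inE /=; case: (e x y).
Qed.

(** Inclusion-exclusion: a remaining vertex meets [a] or [b] in at most one
    edge, unless it lies between them and meets both. *)
Lemma edges_in_delete2 (V : finType) (e : rel V) (S : {set V}) (a b : V) :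
    a \in S -> b \in S :\ a ->
    {in S, forall x, ~~ e x a} -> {in S, forall x, ~~ e b x} ->
  edges_in e S <= edges_in e (S :\ a :\ b)
    + (#|S :\ a :\ b| + #|[set x in S :\ a :\ b | e a x && e x b]|).+1.
Proof.
move=> Sa Sab src snk; set S' := S :\ a :\ b.
have Sb : b \in S by case/setD1P: Sab.
have S'S x : x \in S' -> x \in S by rewrite !inE => /and3P[].
have split_sum (F : V -> nat) :
    \sum_(x in S) F x = F a + (F b + \sum_(x in S') F x).
  by rewrite (big_setD1 a) //= (big_setD1 b).
have rowb : \sum_(y in S) e b y = 0.
  by apply: big1 => y Sy; rewrite (negPf (snk y Sy)).
have rowx : \sum_(x in S') \sum_(y in S) e x y
          = \sum_(x in S') e x b + edges_in e S'.
  rewrite -big_split /=; apply: eq_bigr => x /S'S Sx.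
  by rewrite split_sum (negPf (src x Sx)) add0n.
have both : \sum_(x in S') e a x + \sum_(x in S') e x b
          <= #|S'| + #|[set x in S' | e a x && e x b]|.
  have -> : #|[set x in S' | e a x && e x b]|
          = \sum_(x in S') (e a x && e x b).
    rewrite -sum1_card big_mkcond [RHS]big_mkcond /=.
    apply: eq_bigr => x _; rewrite in_set.
    by case: (x \in S'); case: (e a x); case: (e x b).
  rewrite -sum1_card -!big_split /=.
  by apply: leq_sum => x _; case: (e a x); case: (e x b).
rewrite {1}/edges_in split_sum rowb rowx split_sum (negPf (src a Sa)).
by case: (e a b) => /=; lia.
Qed.

(** Adding the binomial coefficient on the left, instead of subtracting it on
    the right, keeps truncated subtraction out of the induction step. *)
Lemma edges_in_bound (V : finType) (e : rel V) (l : nat) (S : {set V}) :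
    1 <= l -> (forall x p, path e x p -> size p <= l) ->
    extremely_reduced e ->
  edges_in e S + 'C(#|S| - l + 1, 2)
    <= 'C(#|S|, 2) + turan_edges (#|S| - l + 1) 2.
Proof.
move=> l_gt0 bound red.
have [k] := ubnP #|S|; elim: k S => // k IHk S leSk.
have [->|S_n0] := eqVneq S set0.
  by rewrite /edges_in big_set0 cards0 sub0n turan_edges1.
have [a Sa src] := exists_source bound S_n0.
have cardS : #|S| = #|S :\ a|.+1 by rewrite (cardsD1 a) Sa.
have [Sa0|Sa_n0] := eqVneq (S :\ a) set0.
  have -> : S = [set a] by rewrite -(setD1K Sa) Sa0 setU0.
  rewrite /edges_in !big_set1 (negPf (src a Sa)) cards1.
  by rewrite (_ : 1 - l = 0) ?turan_edges1 //; lia.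
have [b Sab snk'] := exists_sink bound Sa_n0.
(* A sink of [S :\ a] is a sink of [S], since no edge enters [a]. *)
have snk : {in S, forall x, ~~ e b x}.
  move=> x Sx; have [->|nxa] := eqVneq x a; last by apply: snk'; rewrite !inE nxa.
  by apply: src; case/setD1P: Sab.
have := edges_in_delete2 Sa Sab src snk.
have := IHk (S :\ a :\ b).
rewrite cardS [#|S :\ a|](cardsD1 b) Sab /= in leSk *.
set S' := S :\ a :\ b; set K := [set x in S' | _].
move=> /(_ (ltnW _)) IH del; have {IH} := IH leSk.
have ltKl : #|K| < l.
  by apply: (card_between_lt l_gt0 bound red (a := a) (b := b)) => x; rewrite inE => /andP[].
have leKS' : #|K| <= #|S'| by apply: subset_leq_card; apply/subsetP=> x; rewrite inE => /andP[].
rewrite !add1n bin2_addn2; case: (leqP l #|S'|) => [le_l|lt_l].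
  rewrite (_ : #|S'|.+2 - l + 1 = (#|S'| - l + 1).+2); last by lia.
  by rewrite turan_edges2_addn2 bin2_addn2; lia.
(* With so few vertices both Turan terms agree with the binomials, and the
   bound is that of the complete graph. *)
rewrite (_ : #|S'| - l + 1 = 1) ?turan_edges1; last by lia.
have [-> | ->] : #|S'|.+2 - l + 1 = 1 \/ #|S'|.+2 - l + 1 = 2 by lia.
  by rewrite turan_edges1; lia.
by rewrite turan_edges22 !binn; lia.
Qed.

Theorem theorem3p17 (V : finType) (e : rel V) (n l : nat)
  (hdag : acyclic e) (hn : #|V| = n)
  (hl : 1 <= l) (hlong : longest_path_length e l)
  (hred : extremely_reduced e) :
  num_edges e <= turan_edges (n - l + 1) 2 + T1 n l.
Proof.
case: hlong => _ bound.
have := edges_in_bound [set: V] hl bound hred.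
rewrite edges_in_setT cardsT hn /T1 => edge_bound.
(* For [n = 0] the Turan part has one vertex, but no pairs. *)
have : 'C(n - l + 1, 2) <= 'C(n, 2).
  by case: (n) => [|n']; [rewrite sub0n | apply: leq_bin2l; lia].
by lia.
Qed.
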